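(* Consider the two-way unsplittable trading problem with known price range $[m,M]$, $0<m<M$, fluctuation ratio $\varphi=M/m$, and at most $k=1$ trade. For every $\epsilon>0$, no deterministic online algorithm has competitive ratio smaller than $\varphi^{1-\epsilon}$; that is, for every deterministic online algorithm there is a price sequence with all prices in $[m,M]$ on which the ratio of the optimal offline return to the algorithm's return is at least $\varphi^{1-\epsilon}$.
   Context: Two-way unsplittable trading problem: a sequence of prices $p(1),p(2),\ldots,p(T)$ (positive reals), one per day, is revealed online; the horizon length $T$ is not known to the online algorithm in advance, but when day $i$ arrives the algorithm learns whether $i=T$. The investor starts with cash and may make at most $k$ trades. A trade is a pair of days $(b,s)$ with $b<s$: on day $b$ all available money is used to buy the stock at price $p(b)$, and on day $s$ all stock held is sold at price $p(s)$. Trades cannot overlap (a sale must happen before the next purchase), there is no short selling, no buying is allowed on the last day $T$, and any stock still held on day $T$ must be sold at price $p(T)$. The gain of a trade $(b,s)$ is $p(s)/p(b)$, and the return of a sequence of trades is the product of their gains (the return is $1$ if no trade is made). The optimal offline algorithm OPT knows the whole sequence and makes at most $k$ trades maximizing the return. The competitive ratio of an online algorithm ONL is the supremum, over all admissible price sequences, of (return of OPT)/(return of ONL). In this model, all prices lie in $[m,M]$ and $m$ and $M$ are known to the online algorithm in advance. *)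

(* Defs.v *)
From mathcomp Require Import all_boot all_order all_algebra.
From mathcomp Require Import all_classical all_reals all_analysis.

Set Implicit Arguments.
Unset Strict Implicit.
Unset Printing Implicit Defensive.

Import Order.TTheory GRing.Theory Num.Theory.

Local Open Scope classical_set_scope.
Local Open Scope ring_scope.

(* Days are numbered from 0, so the last day of p is (size p).-1. A trade is
   a pair (b, s) of a buying day and a selling day. *)
Definition trade : Type := (nat * nat)%type.

(* b < s < T also forbids buying on the last day. *)
Definition feasible (k T : nat) (t : seq trade) : bool :=
  [&& (size t <= k)%N,
      all (fun d : trade => (d.1 < d.2 < T)%N) t
    & sorted (fun d e : trade => (d.2 < e.1)%N) t].

Definition trades_return (R : realType) (p : seq R) (t : seq trade) : R :=
  \prod_(d <- t) (p`_(d.2) / p`_(d.1)).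

Definition opt_return (R : realType) (k : nat) (p : seq R) : R :=
  sup [set trades_return p t | t in [set t | feasible k (size p) t]].

Variant action := Buy | Sell | Wait.

Definition is_buy (a : action) : bool := if a is Buy then true else false.
Definition is_sell (a : action) : bool := if a is Sell then true else false.

(* The arguments are the prices revealed so far, today's included, and whether
   today is the last day. The algorithm being deterministic, its own past
   actions are a function of these. *)
Definition online_algorithm (R : realType) : Type := seq R -> bool -> action.

(* The state is the buying day of the stock held, if any, and the completed
   trades. Inadmissible requests (buying while holding stock, on the last day or
   after k trades; selling without stock) are no-ops; stock held on the last day
   is sold whatever the algorithm answers. *)
Definition online_step (R : realType) (k : nat) (A : online_algorithm R)
    (p : seq R) (st : option nat * seq trade) (i : nat) :
    option nat * seq trade :=
  let last_day := i.+1 == size p in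
  let a := A (take i.+1 p) last_day in
  match st.1 with
  | Some b =>
      if last_day || is_sell a then (None, rcons st.2 (b, i)) else st
  | None =>
      if [&& ~~ last_day, is_buy a & (size st.2 < k)%N]
      then (Some i, st.2) else st
  end.

Definition online_trades (R : realType) (k : nat) (A : online_algorithm R)
    (p : seq R) : seq trade :=
  (foldl (online_step k A p) (None, [::]) (iota 0 (size p))).2.

Definition online_return (R : realType) (k : nat) (A : online_algorithm R)
    (p : seq R) : R :=
  trades_return p (online_trades k A p).

Definition admissible (R : realType) (m M : R) (p : seq R) : bool :=
  (0 < size p)%N && all (fun x => m <= x <= M) p.

Definition competitive_ratio (R : realType) (k : nat) (m M : R)
    (A : online_algorithm R) : \bar R :=
  ereal_sup [set (opt_return k p / online_return k A p)%:E
            | p in [set p | admissible m M p]].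

Lemma online_trades_feasible (R : realType) (k : nat) (A : online_algorithm R)
    (p : seq R) : feasible k (size p) (online_trades k A p).
Proof.
pose inv n (st : option nat * seq trade) :=
  [/\ (size st.2 + st.1 <= k)%N,
      all (fun d : trade => (d.1 < d.2 < n)%N) st.2,
      sorted (fun d e : trade => (d.2 < e.1)%N) st.2
    & forall b, st.1 = Some b ->
        (b < n)%N && all (fun d : trade => (d.2 < b)%N) st.2].
have H n : inv n (foldl (online_step k A p) (None, [::]) (iota 0 n)).
  elim: n => [|n]; first by split.
  rewrite -addn1 iotaD foldl_cat add0n addn1 /=.
  case: (foldl _ _ _) => o t [/= hk ha hs hb].
  have ha' : all (fun d : trade => (d.1 < d.2 < n.+1)%N) t.
    by apply: sub_all ha => d /andP[-> /ltnW].
  rewrite /online_step /=; case: o hk hb => [b|] /= hk hb; case: ifP => hc.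
  - have /andP[bn hall] := hb b erefl.
    split => //=; first by rewrite size_rcons addn0 -addn1.
      by rewrite all_rcons /= bn ltnSn.
    case: t {hk ha ha' hb} hs hall => //= d t hs /andP[h1 h2].
    rewrite rcons_path hs /=.
    have /allP : all (fun e : trade => (e.2 < b)%N) (d :: t) by rewrite /= h1.
    by apply; exact: mem_last.
  - split => //= _ [<-]; have /andP[bn ->] := hb b erefl.
    by rewrite ltnS ltnW.
  - split => //=; first by move: hc => /and3P[_ _]; rewrite addn1.
    by move=> _ [<-]; rewrite ltnSn; apply: sub_all ha => d /andP[].
  - by split.
have [hk ha hs _] := H (size p).
by apply/and3P; split => //; apply: leq_trans hk; rewrite leq_addr.
Qed.

Lemma opt_return_max (R : realType) (k : nat) (p : seq R) :
  exists t, [/\ feasible k (size p) t, opt_return k p = trades_return p t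
    & forall t', feasible k (size p) t' ->
        trades_return p t' <= trades_return p t].
Proof.
pose T := size p.
pose dec (u : k.-tuple (option ('I_T * 'I_T))) : seq trade :=
  [seq (nat_of_ord d.1, nat_of_ord d.2) | d <- pmap id u].
have decP t : feasible k T t -> exists u, dec u = t.
  move=> /and3P[hk ha _].
  pose f (d : trade) : option ('I_T * 'I_T) :=
    if insub d.1 is Some a then
      if insub d.2 is Some b then Some (a, b) else None else None.
  pose s := map f t ++ nseq (k - size t) None.
  have ss : size s == k by rewrite size_cat size_map size_nseq subnKC.
  exists (Tuple ss); rewrite /dec /= /s pmap_cat map_cat.
  have -> : pmap id (nseq (k - size t) (@None ('I_T * 'I_T))) = [::].
    by elim: (k - size t)%N.
  rewrite cats0; elim: t ha {hk s ss} => //= -[a b] t IH /andP[/andP[ab bT] ha].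
  by rewrite /f /= (insubT (fun x => x < T)%N (ltn_trans ab bT))
    (insubT (fun x => x < T)%N bT) /= IH.
pose P (u : k.-tuple (option ('I_T * 'I_T))) := feasible k T (dec u).
have [u0 du0] : exists u, dec u = [::] by apply: decP.
have P0 : P u0 by rewrite /P du0.
have [u Pu umax] :=
  @Order.TotalTheory.arg_maxP _ _ _ u0 P (fun u => trades_return p (dec u)) P0.
have tmax t' : feasible k T t' -> trades_return p t' <= trades_return p (dec u).
  by move=> ft; have [u' du'] := decP _ ft; rewrite -du'; apply: umax; rewrite /P du'.
exists (dec u); split => //; apply/eqP; rewrite eq_le; apply/andP; split.
  apply: ge_sup; first by exists (trades_return p (dec u)), (dec u).
  by move=> _ [t ft <-]; exact: tmax.
apply: ub_le_sup; last by exists (dec u).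
by exists (trades_return p (dec u)) => _ [t ft <-]; exact: tmax.
Qed.

(* Main.v *)
(* Fix q > 1. The adversary alternates the lows M, M / q, M / q^2, ... with the
   peak price M, down to the last low M / q^n that is at least m. If the
   algorithm first buys at the low M / q^(j+1), the price drops to m on the next
   day, which is the last one: the algorithm returns m q^(j+1) / M, while the
   previous low and peak offered the gain q^j, so the ratio is at least
   M / (m q). Buying at the price M is no better, and never buying misses the
   gain q^n > M / (m q). The theorem is the case q = (M / m)^eps. *)
Require Import Defs.
From mathcomp Require Import all_boot all_order all_algebra.
From mathcomp Require Import all_classical all_reals all_analysis.
From mathcomp Require Import ring.

Set Implicit Arguments.
Unset Strict Implicit.
Unset Printing Implicit Defensive.

Import Order.TTheory GRing.Theory Num.Theory.

Local Open Scope ring_scope.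

Lemma take_mkseq (T : Type) (f : nat -> T) (i n : nat) :
  take i (mkseq f n) = mkseq f (minn i n).
Proof. by rewrite /mkseq -map_take take_iota. Qed.

Lemma exprn_itv (R : realType) (q x : R) :
  1 < q -> 1 <= x -> exists n, q ^+ n <= x < q ^+ n.+1.
Proof.
move=> q_gt1 x_ge1; exists (Num.truncn (ln x / ln q)).
have q_gt0 : 0 < q := lt_trans ltr01 q_gt1.
have x_gt0 : 0 < x := lt_le_trans ltr01 x_ge1.
have lnq_gt0 : 0 < ln q by rewrite ln_gt0.
rewrite -[_ <= x]ler_ln ?posrE ?exprn_gt0 //.
rewrite -[x < _]ltr_ln ?posrE ?exprn_gt0 //.
rewrite !lnXn // -!(mulr_natl (ln q)) -ler_pdivlMr // -ltr_pdivrMr //.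
by rewrite truncn_itv // divr_ge0 ?ln_ge0 // ltW.
Qed.

Section OptimalReturn.
Variables (R : realType) (k : nat).
Implicit Type p : seq R.

Lemma trades_return_le_opt_return p (t : seq trade) :
  feasible k (size p) t -> trades_return p t <= opt_return k p.
Proof. by have [u [_ -> umax]] := opt_return_max k p; exact: umax. Qed.

Lemma opt_return_ge1 p : 1 <= opt_return k p.
Proof.
have := @trades_return_le_opt_return p [::] isT.
by rewrite /trades_return big_nil.
Qed.

Lemma gain_le_opt_return p (b s : nat) :
  (0 < k)%N -> (b < s < size p)%N -> p`_s / p`_b <= opt_return k p.
Proof.
move=> k_gt0 bs; have := @trades_return_le_opt_return p [:: (b, s)].
by rewrite /feasible /= k_gt0 bs /trades_return big_seq1; apply.
Qed.

End OptimalReturn.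

Lemma le_competitive_ratio (R : realType) (k : nat) (m M : R)
    (A : online_algorithm R) (p : seq R) :
  admissible m M p ->
  ((opt_return k p / online_return k A p)%:E <= competitive_ratio k m M A)%E.
Proof. by move=> adm_p; apply: ereal_sup_ubound; exists p. Qed.

Section OnlineReturn.
Variables (R : realType) (k : nat) (A : online_algorithm R).
Implicit Types p s : seq R.

(* Day i is taken not to be the last one, even if it ends p: an algorithm that
   declines on all of p can be stopped there, and one that does not can be
   stopped one day after its first purchase. *)
Definition declines p (i : nat) : bool := ~~ is_buy (A (take i.+1 p) false).

Lemma foldl_online_step_declines p (days : seq nat) (t : seq trade) :
  all (declines p) days ->
  foldl (online_step k A p) (None, t) days = (None, t).
Proof.
elim: days => //= i days IHdays /andP[declines_i /IHdays].
suff -> : online_step k A p (None, t) i = (None, t) by [].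
rewrite /online_step /=; case: (i.+1 == size p) => //=.
by rewrite (negbTE declines_i).
Qed.

Lemma online_return_declines p :
  all (declines p) (iota 0 (size p)) -> online_return k A p = 1.
Proof.
move=> declines_p; rewrite /online_return /online_trades.
by rewrite foldl_online_step_declines // /trades_return big_nil.
Qed.

Hypothesis k_gt0 : (0 < k)%N.

Lemma online_return_buy_penultimate p (i : nat) :
  size p = i.+2 -> all (declines p) (iota 0 i) -> ~~ declines p i ->
  online_return k A p = p`_i.+1 / p`_i.
Proof.
move=> size_p declines_p /negbNE buy_i; rewrite /online_return /online_trades.
rewrite size_p -addn2 iotaD foldl_cat foldl_online_step_declines //=.
by rewrite /online_step /= size_p eqSS ltn_eqF //= buy_i k_gt0 /= eqxx
  /trades_return big_seq1.
Qed.

Lemma online_return_declines_or_crash s (y : R) :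
  online_return k A s = 1 \/
  exists2 i, (i < size s)%N
    & online_return k A (rcons (take i.+1 s) y) = y / s`_i.
Proof.
have [/online_return_declines|] := boolP (all (declines s) (iota 0 (size s))).
  by left.
rewrite -has_predC => buys; right.
pose i := find (predC (declines s)) (iota 0 (size s)).
have lt_i : (i < size s)%N by rewrite -[ltnRHS](size_iota 0) -has_find.
have buy_i := nth_find 0%N buys; rewrite nth_iota // in buy_i.
exists i => //; set p := rcons _ y.
have declines_p j : (j <= i)%N -> declines p j = declines s j.
  move=> le_ji; rewrite /declines /p -cats1 takel_cat ?take_takel //.
  by rewrite size_takel.
rewrite (@online_return_buy_penultimate p i).
- by rewrite !nth_rcons size_takel // ltnn eqxx ltnSn nth_take.
- by rewrite size_rcons size_takel.
- apply/allP => j; rewrite mem_iota add0n => /= lt_ji.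
  have := before_find 0%N lt_ji; rewrite nth_iota ?(ltn_trans lt_ji) //.
  by move=> /negbFE; rewrite declines_p // ltnW.
- by rewrite declines_p.
Qed.

Lemma crash_adversary (m M y r : R) s :
  m <= y <= M -> admissible m M s ->
  (forall i, (i < size s)%N ->
     r <= opt_return k (rcons (take i.+1 s) y) * (s`_i / y)) ->
  r <= opt_return k s ->
  exists p, admissible m M p /\ r <= opt_return k p / online_return k A p.
Proof.
move=> bounds_y adm_s crash_s r_le_opt.
have [ret1|[i lt_i ret_i]] := online_return_declines_or_crash s y.
  by exists s; rewrite ret1 divr1.
exists (rcons (take i.+1 s) y); split; last by rewrite ret_i invf_div crash_s.
have /andP[_ /allP bounds_s] := adm_s.
rewrite /admissible size_rcons all_rcons bounds_y /=.
by apply/allP => x /mem_take; exact: bounds_s.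
Qed.

End OnlineReturn.

Section Zigzag.
Variables (R : realType) (m M q : R) (k : nat).
Hypotheses (m_gt0 : 0 < m) (le_mM : m <= M) (q_gt1 : 1 < q).
Hypothesis k_gt0 : (0 < k)%N.

Definition zigzag_price (i : nat) : R := if odd i then M else M / q ^+ i./2.

Let M_gt0 : 0 < M := lt_le_trans m_gt0 le_mM.
Let q_gt0 : 0 < q := lt_trans ltr01 q_gt1.

Lemma zigzag_price_odd (j : nat) : zigzag_price j.*2.+1 = M.
Proof. by rewrite /zigzag_price /= odd_double. Qed.

Lemma zigzag_price_double (j : nat) : zigzag_price j.*2 = M / q ^+ j.
Proof. by rewrite /zigzag_price odd_double doubleK. Qed.

Lemma zigzag_price_bounds (n i : nat) :
  q ^+ n <= M / m -> (i < n.+1.*2)%N -> m <= zigzag_price i <= M.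
Proof.
move=> qn_le lt_i; rewrite /zigzag_price; case: ifP => _.
  by rewrite le_mM lexx.
rewrite ler_pdivlMr ?ler_pdivrMr ?exprn_gt0 // mulrC.
rewrite -ler_pdivlMr // (le_trans _ qn_le) /=; last first.
  by rewrite ler_eXn2l // -ltnS ltn_half_double.
by rewrite ler_peMr ?exprn_ege1 // ltW.
Qed.

Lemma zigzag_opt_return_ge (j n : nat) (s : seq R) :
  (j.*2.+1 < n)%N -> q ^+ j <= opt_return k (mkseq zigzag_price n ++ s).
Proof.
move=> lt_jn; set p := _ ++ s.
have price_p i : (i <= j.*2.+1)%N -> p`_i = zigzag_price i.
  move=> le_i; have lt_in := leq_ltn_trans le_i lt_jn.
  by rewrite nth_cat size_mkseq lt_in nth_mkseq.
have -> : q ^+ j = p`_j.*2.+1 / p`_j.*2.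
  rewrite !price_p // zigzag_price_odd zigzag_price_double invf_div mulrC.
  by rewrite divfK ?gt_eqF.
by apply: gain_le_opt_return; rewrite // ltnSn size_cat size_mkseq ltn_addr.
Qed.

Lemma zigzag_crash_opt_return_ge (i : nat) :
  M / m / q <=
    opt_return k (rcons (mkseq zigzag_price i.+1) m) * (zigzag_price i / m).
Proof.
have [peak_i|[j ->]] : zigzag_price i = M \/ exists j, i = j.+1.*2.
- have [odd_i|even_i] := boolP (odd i).
    by left; rewrite /zigzag_price odd_i.
  move: (even_halfK even_i) => <-; case: i./2 => [|j]; last by right; exists j.
  by left; rewrite zigzag_price_double divr1.
- have Mm_ge0 : 0 <= M / m by rewrite divr_ge0 ?ltW.
  rewrite peak_i (@le_trans _ _ (M / m)) //; last first.
    by rewrite ler_peMl // opt_return_ge1.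
  by rewrite ler_pdivrMr // ler_peMr // ltW.
- rewrite zigzag_price_double.
  have -> : M / m / q = q ^+ j * (M / q ^+ j.+1 / m).
    by rewrite exprSr; field; rewrite !gt_eqF ?exprn_gt0.
  rewrite ler_wpM2r //; first by rewrite !divr_ge0 ?exprn_ge0 ?ltW.
  by rewrite -cats1 zigzag_opt_return_ge // doubleS.
Qed.

Lemma zigzag_adversary (A : online_algorithm R) :
  exists p, admissible m M p /\
    M / m / q <= opt_return k p / online_return k A p.
Proof.
have Mm_ge1 : 1 <= M / m by rewrite ler_pdivlMr // mul1r.
have [n /andP[qn_le /ltW le_qnS]] := exprn_itv q_gt1 Mm_ge1.
apply: (@crash_adversary _ _ _ k_gt0 m M m _ (mkseq zigzag_price n.+1.*2)).
- by rewrite lexx.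
- rewrite /admissible size_mkseq; apply/(all_nthP 0) => i.
  rewrite size_mkseq => lt_i; rewrite nth_mkseq //.
  exact: zigzag_price_bounds qn_le lt_i.
- move=> i; rewrite size_mkseq => lt_i.
  rewrite take_mkseq (minn_idPl lt_i) nth_mkseq //.
  exact: zigzag_crash_opt_return_ge.
- rewrite -[mkseq _ _]cats0 ler_pdivrMr // (le_trans le_qnS) // exprSr.
  by rewrite ler_wpM2r ?zigzag_opt_return_ge // ltW.
Qed.

End Zigzag.

Theorem theorem1 (R : realType) (m M : R) (m_gt0 : 0 < m) (m_lt_M : m < M)
    (eps : R) (eps_gt0 : 0 < eps) (A : online_algorithm R) :
  ((((M / m) `^ (1 - eps))%:E <= competitive_ratio 1 m M A)%E) /\
  (exists p : seq R, admissible m M p /\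
     (M / m) `^ (1 - eps) <= opt_return 1 p / online_return 1 A p).
Proof.
have ratio_gt1 : 1 < M / m by rewrite ltr_pdivlMr // mul1r.
have ratio_gt0 : 0 < M / m := lt_trans ltr01 ratio_gt1.
have q_gt1 : 1 < (M / m) `^ eps.
  have : 1 `^ eps < (M / m) `^ eps by rewrite gt0_ltr_powR ?nnegrE // ltW.
  by rewrite powR1.
have -> : (M / m) `^ (1 - eps) = M / m / (M / m) `^ eps.
  by rewrite powRB ?(gt_eqF ratio_gt0) ?implybT // powRr1 // ltW.
have [p [adm_p ratio_p]] :=
  zigzag_adversary m_gt0 (ltW m_lt_M) q_gt1 (ltn0Sn 0) A.
split; last by exists p.
apply: le_trans (le_competitive_ratio 1 A adm_p).
by rewrite lee_fin.
Qed.
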